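(* Let $R$ be a ring, $S$ an $m$-system of $R$, $M$ a multiplication right $R$-module, and $P$ a submodule of $M$. (1) $(P:_R M)$ is a right $S$-prime ideal of $R$ if and only if $P$ is an $S$-prime submodule of $M$. (2) If $P$ is an $S$-prime submodule of $M$, then $\mathrm{Ann}(M)\subseteq I$ for some right $S$-prime ideal $I$ of $R$.
   Context: Rings are associative with unity and modules are right (unital) modules. ''Ideal'' means proper two-sided ideal. For $s\in R$, $\langle s\rangle$ denotes the two-sided ideal generated by $s$. A nonempty subset $S\subseteq R$ is an $m$-system if for all $a,b\in S$ there is $r\in R$ with $arb\in S$. $(P:_R M)=\{r\in R: Mr\subseteq P\}$ and $\mathrm{Ann}(M)=\{r\in R: Mr=0\}$. A right $R$-module $M$ is a multiplication module if $N=M(N:_R M)$ for every submodule $N$ of $M$, where $MI$ denotes the submodule generated by the products $mi$ ($m\in M$, $i\in I$). A submodule $P$ of $M$ is $S$-prime if $(P:_R M)\cap S=\emptyset$ and there is $s\in S$ such that for all $a\in R$ and $m\in M$, $mRa\subseteq P$ implies $a\langle s\rangle\subseteq (P:_R M)$ or $m\langle s\rangle\subseteq P$. An ideal $Q$ of $R$ is a right $S$-prime ideal if $Q\cap S=\emptyset$ and there is $s\in S$ such that for all ideals $A,B$ of $R$, $AB\subseteq Q$ implies $A\langle s\rangle\subseteq Q$ or $B\langle s\rangle\subseteq Q$. *)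

(* Defs.v *)
From mathcomp Require Import all_boot all_order all_algebra.
From mathcomp Require Import boolp classical_sets.

Set Implicit Arguments.
Unset Strict Implicit.
Unset Printing Implicit Defensive.

Import GRing.Theory.
Local Open Scope ring_scope.
Local Open Scope classical_set_scope.

(* A right R-module is a left module over the converse ring R^c; [rscale m r]
   is the right action m r, so that (m a) b = m (a b) for the product of R. *)
Definition rscale (R : pzRingType) (M : lmodType R^c) (m : M) (r : R) : M :=
  (r : R^c) *: m.

Definition submodule (R : pzRingType) (M : lmodType R^c) (N : set M) : Prop :=
  GRing.submod_closed [in N].

(* Possibly improper two-sided ideal, needed since <s> may be all of R. *)
Definition twosided (R : pzRingType) (A : set R) : Prop :=
  GRing.zmod_closed [in A] /\
  (forall r a : R, A a -> A (r * a) /\ A (a * r)).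

Definition ideal (R : pzRingType) (A : set R) : Prop :=
  twosided A /\ A <> setT.

Definition ideal_gen (R : pzRingType) (s : R) : set R :=
  smallest (@twosided R) [set s].

(* Finite sums of products a * b. *)
Definition ideal_mul (R : pzRingType) (A B : set R) : set R :=
  smallest (fun X : set R => GRing.zmod_closed [in X])
    [set a * b | a in A & b in B].

Definition m_system (R : pzRingType) (S : set R) : Prop :=
  S !=set0 /\
  (forall a b : R, S a -> S b -> exists r : R, S (a * r * b)).

Definition colon (R : pzRingType) (M : lmodType R^c) (P : set M) : set R :=
  [set r | forall m : M, P (rscale m r)].

Definition annihilator (R : pzRingType) (M : lmodType R^c) : set R :=
  [set r | forall m : M, rscale m r = 0].

(* M I *)
Definition module_mul (R : pzRingType) (M : lmodType R^c) (I : set R) : set M :=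
  smallest (@submodule R M) [set rscale m i | m in [set: M] & i in I].

Definition multiplication_module (R : pzRingType) (M : lmodType R^c) : Prop :=
  forall N : set M, submodule N -> N = module_mul (colon N).

Definition S_prime_submodule (R : pzRingType) (M : lmodType R^c)
    (S : set R) (P : set M) : Prop :=
  [/\ submodule P,
      colon P `&` S = set0 &
      exists2 s : R, S s &
        forall (a : R) (m : M),
          [set rscale m (r * a) | r in [set: R]] `<=` P ->
          [set a * t | t in ideal_gen s] `<=` colon P \/
          [set rscale m t | t in ideal_gen s] `<=` P].

Definition right_S_prime_ideal (R : pzRingType) (S Q : set R) : Prop :=
  [/\ ideal Q,
      Q `&` S = set0 &
      exists2 s : R, S s &
        forall A B : set R, ideal A -> ideal B ->
          ideal_mul A B `<=` Q ->
          ideal_mul A (ideal_gen s) `<=` Q \/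
          ideal_mul B (ideal_gen s) `<=` Q].

(* Main.v *)
Require Import Defs.
From mathcomp Require Import all_boot all_order all_algebra.
From mathcomp Require Import boolp classical_sets.

(** The equivalence rests on reading [m R a] inside [P] as a product of ideals
    inside [(P : M)].

    If [P] is [S]-prime with witness [s] and [A B] lies in [(P : M)], suppose
    that [A <s>] does not, say [m a t] is outside [P] with [a] in [A] and [t]
    in [<s>].  Since [R b <= B], the element [m a] satisfies [(m a) R b <= P]
    for every [b] in [B], and [(m a) <s>] is not contained in [P], so [b <s>] lies in
    [(P : M)] for every [b] in [B]: the same [s] works for the ideal.

    Conversely let [s] witness that [(P : M)] is right [S]-prime, and let
    [m R a] lie in [P].  Take [A = (m R : M)] and [B = (P : m R)], the largest
    ideals with [M A <= m R] and [(m R) B <= P]; then [A B] lies in [(P : M)]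
    and [a] is in [B].  If [B <s>] lies in [(P : M)], so does [a <s>].  If
    [A <s>] does, then [m <s>] lies in [P], because [m R = M A] in a
    multiplication module.  As primeness is tested on proper ideals, the cases
    [A = R] (then [M = m R], so [M a <= P]) and [B = R] (then [m] is in [P])
    are settled directly.

    For the second part the ideal is [(P : M)] itself, which contains [Ann M]
    because [P] contains 0. *)

Set Implicit Arguments.
Unset Strict Implicit.
Unset Printing Implicit Defensive.

Import GRing.Theory.
Local Open Scope ring_scope.
Local Open Scope classical_set_scope.

Section Residuals.
Variables (R : pzRingType) (M : lmodType R^c).
Implicit Types (N P : set M) (m : M) (A : set R) (r s t : R).

Lemma rscaleM m r t : rscale m (r * t) = rscale (rscale m r) t.
Proof. by rewrite /rscale scalerA. Qed.

Lemma rscale1 m : rscale m 1 = m.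
Proof. exact: scale1r. Qed.

Lemma rscale0 m : rscale m 0 = 0.
Proof. exact: scale0r. Qed.

Lemma rscaleB m r t : rscale m (r - t) = rscale m r - rscale m t.
Proof. exact: scalerBl. Qed.

Lemma rscaleDl m n r : rscale (m + n) r = rscale m r + rscale n r.
Proof. exact: scalerDr. Qed.

Lemma rscale0l r : rscale (0 : M) r = 0.
Proof. exact: scaler0. Qed.

Lemma submoduleE N :
  submodule N <-> N 0 /\ forall r m n, N m -> N n -> N (rscale m r + n).
Proof.
split=> [[N0 NL]|[N0 NL]]; split; rewrite ?inE //.
- by move: N0; rewrite inE.
- by move=> r m n Nm Nn; have := NL r m n; rewrite !inE; apply.
- by move=> r m n; rewrite !inE; apply: NL.
Qed.

Lemma submodule_scale N m r : submodule N -> N m -> N (rscale m r).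
Proof.
by case/submoduleE=> N0 NL Nm; rewrite -[rscale m r]addr0; apply: NL.
Qed.

Lemma submodule_sub N m n : submodule N -> N m -> N n -> N (m - n).
Proof.
case/submoduleE=> _ NL Nm Nn.
by have := NL (-1) n m Nn Nm; rewrite /rscale scaleN1r addrC.
Qed.

Lemma zmod_closedE (V : zmodType) (X : set V) :
  GRing.zmod_closed [in X] <-> X 0 /\ forall x y, X x -> X y -> X (x - y).
Proof.
split=> [[X0 XB]|[X0 XB]]; split; rewrite ?inE //.
- by move: X0; rewrite inE.
- by move=> x y Xx Xy; have := XB x y; rewrite !inE; apply.
- by move=> x y; rewrite !inE; apply: XB.
Qed.

Lemma ideal_gen_mull s r t : ideal_gen s t -> ideal_gen s (r * t).
Proof. by move=> st I [Itwo Is]; apply: (Itwo.2 r t _).1; apply: st. Qed.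

Definition cyclic_submodule m : set M := [set rscale m r | r in [set: R]].

Lemma cyclic_submoduleP m : submodule (cyclic_submodule m).
Proof.
apply/submoduleE; split; first by exists 0; rewrite ?rscale0.
move=> r _ _ [a _ <-] [b _ <-]; exists (a * r + b) => //.
by rewrite -rscaleM /rscale scalerDl.
Qed.

Lemma mem_cyclic_submodule m : cyclic_submodule m m.
Proof. by exists 1; rewrite ?rscale1. Qed.

Definition residual P N : set R :=
  [set r | forall n, N n -> P (rscale n r)].

(** Right multiples stay in the residual because [P] is stable under scaling,
    left multiples because [N] is. *)
Lemma twosided_residual P N : submodule P ->
  (forall n r, N n -> N (rscale n r)) -> twosided (residual P N).
Proof.
move=> subP stabN; split.
  apply/zmod_closedE; split.
    by move=> n _; rewrite rscale0; case/submoduleE: subP.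
  by move=> r t Pr Pt n Nn; rewrite rscaleB; apply: submodule_sub; auto.
move=> r a Pa; split=> n Nn; rewrite rscaleM; first by apply/Pa/stabN.
by apply: submodule_scale => //; apply: Pa.
Qed.

Lemma colonE P : colon P = residual P setT.
Proof. by apply/seteqP; split=> r Pr m; [move=> _|]; apply: Pr. Qed.

Lemma twosided_colon P : submodule P -> twosided (colon P).
Proof. by move=> subP; rewrite colonE; apply: twosided_residual. Qed.

Lemma colon_annihilator P : submodule P -> annihilator M `<=` colon P.
Proof. by case/submoduleE=> P0 _ r Mr0 m; rewrite Mr0. Qed.

(** The elements that all of [<s>] sends into [P] form a submodule, since
    [<s>] absorbs scalars on its left; a product [M A] can therefore be tested
    on its generators. *)
Lemma module_mul_ideal_gen P A s : submodule P ->
  ideal_mul A (ideal_gen s) `<=` colon P ->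
  forall m, module_mul A m -> [set rscale m t | t in ideal_gen s] `<=` P.
Proof.
move=> subP AsP m MAm _ [t st <-]; have /submoduleE[P0 PL] := subP.
pose X : set M := [set x | forall t, ideal_gen s t -> P (rscale x t)].
suff: X m by apply.
apply: MAm; split.
  apply/submoduleE; split=> [u _|r x y Xx Xy u su]; first by rewrite rscale0l.
  rewrite rscaleDl -rscaleM -[rscale x _]rscale1.
  by apply: PL; [apply: Xx; apply: ideal_gen_mull|apply: Xy].
move=> _ [x _ [a Aa <-]] u su; rewrite -rscaleM.
by apply: AsP => I [_]; apply; exists a => //; exists u.
Qed.

(** Nonemptiness of [S] is what makes [(P : M)] proper: it misses an element
    of [R]. The element [m a] of the proof plays the role of [m] in the
    primeness of [P], so one witness [s] serves all pairs [A], [B]. *)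
Lemma S_prime_colon S P : S !=set0 ->
  S_prime_submodule S P -> right_S_prime_ideal S (colon P).
Proof.
move=> [s0 Ss0] [subP PS0 [s Ss sP]].
have twoP := twosided_colon subP.
split=> //.
- split=> // PT; have : (colon P `&` S) s0 by split=> //; rewrite PT.
  by rewrite PS0.
exists s => // A B _ [[_ Bmul] _] ABP.
have [AsP|/existsNP[a /existsNP[t /not_implyP[Aa /not_implyP[st]]]]] :=
  pselect (forall a t, A a -> ideal_gen s t -> colon P (a * t)).
  by left; apply: smallest_sub twoP.1 _ => _ [a Aa [t st <-]]; apply: AsP.
move=> /existsNP[m NPmat]; right.
apply: smallest_sub twoP.1 _ => _ [b Bb [u su <-]].
have [|bsP|masP] := sP b (rscale m a).
- move=> _ [r _ <-]; rewrite -rscaleM; apply: ABP => I [_]; apply.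
  by exists a => //; exists (r * b) => //; apply: (Bmul r b Bb).1.
- by apply: bsP; exists u.
- by case: NPmat; rewrite rscaleM; apply: masP; exists t.
Qed.

(** The two residuals turn the elementwise condition [m R a <= P] into an
    inclusion of a product of ideals; the multiplication hypothesis is used
    only for [m R], to return from [(m R : M)] to [m]. *)
Lemma colon_S_prime S P : multiplication_module M -> submodule P ->
  right_S_prime_ideal S (colon P) -> S_prime_submodule S P.
Proof.
move=> multM subP [_ PS0 [s Ss sP]]; split=> //.
exists s => // a m mRaP; have [_ colonP] := twosided_colon subP.
pose N := cyclic_submodule m; pose A := colon N; pose B := residual P N.
have subN : submodule N := cyclic_submoduleP m.
have Ba : B a by move=> _ [r _ <-]; rewrite -rscaleM; apply: mRaP; exists r.
have twoB : twosided B.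
  by apply: twosided_residual => // n r; apply: submodule_scale.
have [AT|properA] := pselect (A = setT).
  have MN n : N n by rewrite -[n]rscale1; have : A 1 by [rewrite AT]; apply.
  left=> _ [t _ <-]; apply: (colonP t a _).2 => n.
  exact/Ba/MN.
have [BT|properB] := pselect (B = setT).
  have Pm : P m.
    rewrite -[m]rscale1; have : B 1 by rewrite BT.
    by apply; apply: mem_cyclic_submodule.
  by right=> _ [t _ <-]; apply: submodule_scale.
have [|||AsP|BsP] := sP A B.
- by split=> //; apply: twosided_colon.
- by split.
- apply: smallest_sub; first exact: (twosided_colon subP).1.
  by move=> _ [x Ax [y By <-]] n; rewrite rscaleM; apply/By/Ax.
- right; apply: (module_mul_ideal_gen subP AsP).
  by rewrite -(multM N subN); apply: mem_cyclic_submodule.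
- left=> _ [t st <-]; apply: BsP => I [_]; apply.
  by exists a => //; exists t.
Qed.
End Residuals.

Theorem corollary2p9 (R : pzRingType) (S : set R) (M : lmodType R^c)
    (P : set M) (hS : m_system S) (hM : multiplication_module M)
    (hP : submodule P) :
  (right_S_prime_ideal S (colon P) <-> S_prime_submodule S P) /\
  (S_prime_submodule S P ->
   exists2 I : set R, right_S_prime_ideal S I & annihilator M `<=` I).
Proof.
have [S0 _] := hS; split.
  by split; [apply: colon_S_prime|apply: S_prime_colon].
by exists (colon P); [apply: S_prime_colon|apply: colon_annihilator].
Qed.
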